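(* Let $G=(V,E)$ be a simple undirected graph with no isolated vertices, $|V|=n$, $|E|=m$, incidence matrix $A=A(G)$ and degree vector $\mathbf{d}(G)$. Let $c\in\mathbb{R}$ and $a\le b$ real. The following are equivalent: \begin{enumerate} \item $G$ has a $c$-sum $[a,b]$-flow; \item $G$ has a nonnegative $(c\mathbf{1}_n-a\mathbf{d}(G))$-flow whose value on each edge is at most $b-a$; \item for each $\mathbf{w}\in\mathbb{R}_+^m$, \[\max\{(c\mathbf{1}_n-a\mathbf{d}(G))^\top\mathbf{z}\;:\;\mathbf{z}\in\mathbb{R}^n,\ A^\top\mathbf{z}\le\mathbf{w}\}\le(b-a)\,\mathbf{1}_m^\top\mathbf{w}.\] \end{enumerate}
   Context: The vertex–edge incidence matrix $A(G)$ has entry $1$ in position $(v,e)$ if $v\in e$ and $0$ otherwise; $\mathbf{d}(G)=(\deg v)_{v\in V}$. For $\gamma\in\mathbb{R}^V$, a $\gamma$-flow is a function $\omega:E\to\mathbb{R}$ with $\sum_{e\ni v}\omega(e)=\gamma(v)$ for every vertex $v$; a $c$-sum $L$-flow is a $\gamma$-flow with $\gamma(v)=c$ for all $v$ and all values in $L$. *)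

(* Defs.v *)
From HB Require Import structures.
From mathcomp Require Import all_boot all_order all_algebra.
From mathcomp Require Import classical_sets set_interval reals.

Set Implicit Arguments.
Unset Strict Implicit.
Unset Printing Implicit Defensive.

Import Order.TTheory GRing.Theory Num.Theory.

Local Open Scope ring_scope.

(* Edges are the two-element sets of vertices in [edges]; loops and parallel
   edges are thereby excluded. *)
Record sgraph := SGraph {
  vertex :> finType;
  edges : {set {set vertex}};
  edges_card2 : forall e, e \in edges -> #|e| = 2%N
}.

Definition edge (G : sgraph) := {e : {set G} | e \in edges G}.

Definition order_of (G : sgraph) : nat := #|{: vertex G}|.
Definition size_of (G : sgraph) : nat := #|{: edge G}|.

Definition deg (G : sgraph) (v : G) : nat := #|[set e : edge G | v \in val e]|.

Definition no_isolated (G : sgraph) : Prop := forall v : G, (0 < deg v)%N.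

(* Vectors in R^V and R^E are identified with column vectors of R^n and R^m
   through the canonical enumerations [enum_val]/[enum_rank] of vertices and
   edges. *)
Definition incidence (R : realType) (G : sgraph) :
    'M[R]_(order_of G, size_of G) :=
  \matrix_(i, k) ((enum_val i : G) \in val (enum_val k : edge G))%:R.

Definition degvec (R : realType) (G : sgraph) : 'cV[R]_(order_of G) :=
  \col_i (deg (enum_val i : G))%:R.

Definition ones (R : realType) (n : nat) : 'cV[R]_n := const_mx 1.

Definition dot (R : realType) (n : nat) (u v : 'cV[R]_n) : R :=
  (u^T *m v) 0 0.

Definition lev (R : realType) (n : nat) (u v : 'cV[R]_n) : Prop :=
  forall i, u i 0 <= v i 0.

Definition is_flow (R : realType) (G : sgraph) (gamma : 'cV[R]_(order_of G))
    (omega : edge G -> R) : Prop :=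
  forall v : G,
    \sum_(e : edge G | v \in val e) omega e = gamma (enum_rank v) 0.

Definition is_csum_flow (R : realType) (G : sgraph) (c : R) (L : set R)
    (omega : edge G -> R) : Prop :=
  is_flow (c *: ones R (order_of G)) omega /\ forall e, L (omega e).

Definition is_max (R : realType) (S : set R) (M : R) : Prop :=
  S M /\ ubound S M.

(* [max S <= B]: the maximum is attained and at most [B]; a set without a
   maximum (in particular one unbounded above) does not satisfy it. *)
Definition max_le (R : realType) (S : set R) (B : R) : Prop :=
  exists2 M : R, is_max S M & M <= B.

(* Main.v *)
(* (1) and (2) differ by the shift [omega - a].  A flow as in (2) bounds the
   linear program in (3) by weak duality; conversely, (3) is exactly the dual
   condition that Farkas' lemma asks for the solvability of
   [A omega = gamma, omega + s = (b - a) 1, omega, s >= 0].  That the maximum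
   in (3) is attained is a second application of Farkas' lemma. *)
Require Import Defs.
From mathcomp Require Import all_boot all_order all_algebra.
From mathcomp Require Import boolp classical_sets set_interval reals.
From mathcomp Require Import lra.

Set Implicit Arguments.
Unset Strict Implicit.
Unset Printing Implicit Defensive.

Import Order.TTheory GRing.Theory Num.Theory.

Local Open Scope ring_scope.
Local Open Scope classical_set_scope.

Section Dot.
Variables (R : realType) (n : nat).
Implicit Types u v : 'cV[R]_n.

Lemma dotE u v : dot u v = \sum_i u i 0 * v i 0.
Proof. by rewrite /dot mxE; apply: eq_bigr => i _; rewrite mxE. Qed.

Lemma dotC u v : dot u v = dot v u.
Proof. by rewrite !dotE; apply: eq_bigr => i _; rewrite mulrC. Qed.

Lemma dotDr u v1 v2 : dot u (v1 + v2) = dot u v1 + dot u v2.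
Proof. by rewrite /dot mulmxDr mxE. Qed.

Lemma dotZr u k v : dot u (k *: v) = k * dot u v.
Proof. by rewrite /dot -scalemxAr mxE. Qed.

Lemma dotNr u v : dot u (- v) = - dot u v.
Proof. by rewrite -scaleN1r dotZr mulN1r. Qed.

Lemma dotDl u1 u2 v : dot (u1 + u2) v = dot u1 v + dot u2 v.
Proof. by rewrite dotC dotDr !(dotC v). Qed.

Lemma dotZl k u v : dot (k *: u) v = k * dot u v.
Proof. by rewrite dotC dotZr dotC. Qed.

Lemma dotNl u v : dot (- u) v = - dot u v.
Proof. by rewrite dotC dotNr dotC. Qed.

Lemma dot0r u : dot u 0 = 0.
Proof. by rewrite /dot mulmx0 mxE. Qed.

Lemma dot_suml m (k : 'I_m -> R) (a : 'I_m -> 'cV[R]_n) v :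
  dot (\sum_i k i *: a i) v = \sum_i k i * dot (a i) v.
Proof.
elim/big_rec2: _ => [|i x y _ <-]; first by rewrite dotC dot0r.
by rewrite dotDl dotZl.
Qed.

Lemma ler_dot u v1 v2 : lev 0 u -> lev v1 v2 -> dot u v1 <= dot u v2.
Proof.
move=> u0 v12; rewrite !dotE; apply: ler_sum => i _.
by apply: ler_wpM2l => //; have := u0 i; rewrite mxE.
Qed.

Lemma dot_col_mx p (u1 v1 : 'cV[R]_n) (u2 v2 : 'cV[R]_p) :
  dot (col_mx u1 u2) (col_mx v1 v2) = dot u1 v1 + dot u2 v2.
Proof. by rewrite /dot tr_col_mx mul_row_col mxE. Qed.

End Dot.

Lemma dot_mulmxl (R : realType) n m (A : 'M[R]_(n, m)) y z :
  dot (A *m y) z = dot y (A^T *m z).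
Proof. by rewrite /dot trmx_mul mulmxA. Qed.

Lemma dot1 (R : realType) (u v : 'cV[R]_1) : dot u v = u 0 0 * v 0 0.
Proof. by rewrite dotE big_ord1. Qed.

Lemma lev_col_mx (R : realType) n p (u1 v1 : 'cV[R]_n) (u2 v2 : 'cV[R]_p) :
  lev (col_mx u1 u2) (col_mx v1 v2) <-> lev u1 v1 /\ lev u2 v2.
Proof.
split=> [h|[h1 h2] i].
  by split=> i; [have := h (lshift _ i)|have := h (rshift _ i)];
    rewrite ?col_mxEu ?col_mxEd.
by case: (split_ordP i) => j ->; rewrite ?col_mxEu ?col_mxEd.
Qed.

(* Bartl's induction: if [x0] satisfies all the constraints but the first one
   and violates the conclusion, normalise [a ord0] to be 1 at [x0] and project
   along [x0] onto the kernel of [a ord0], which removes that constraint. *)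
Lemma farkas_family (R : realType) n m (a : 'I_m -> 'cV[R]_n) (b : 'cV[R]_n) :
  (forall x, (forall i, dot (a i) x <= 0) -> dot b x <= 0) ->
  exists2 l : 'I_m -> R, forall i, 0 <= l i & b = \sum_i l i *: a i.
Proof.
elim: m a b => [|m IH] a b hab.
  exists (fun=> 0) => //; rewrite big_ord0; apply/colP => i; rewrite mxE.
  (* Without constraints [b] itself is a test vector, so its squared norm is nonpositive. *)
  have : dot b b <= 0 by apply: hab => -[].
  rewrite dotE => le0; apply/eqP; rewrite -sqrf_eq0 expr2.
  have ge0 j : true -> 0 <= b j 0 * b j 0 by rewrite -expr2 sqr_ge0.
  have /eqP := le_anti (introT andP (conj le0 (sumr_ge0 _ ge0))).
  by rewrite psumr_eq0 // => /allP/(_ i (mem_index_enum _)).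
pose a' i := a (lift ord0 i).
have [h|/existsNP[x0 /not_implyP[x0a /negP]]] :=
    EM (forall x, (forall i, dot (a' i) x <= 0) -> dot b x <= 0).
  have [l l0 ->] := IH _ _ h.
  exists (fun i => if unlift ord0 i is Some j then l j else 0).
    by move=> i; case: unliftP.
  rewrite big_ord_recl unlift_none scale0r add0r.
  by apply: eq_bigr => i _; rewrite liftK.
rewrite -ltNge => bx0.
have ax0 : 0 < dot (a ord0) x0.
  rewrite ltNge; apply/negP => ax0; move: bx0; rewrite ltNge => /negP; apply.
  by apply: hab => i; case: (unliftP ord0 i) => [j|] ->; first exact: x0a.
have [q [aq a'q bq]] : exists q : 'cV[R]_n,
    [/\ dot (a ord0) q = 1, forall i, dot (a' i) q <= 0 & 0 <= dot b q].
  have ax0V : 0 <= (dot (a ord0) x0)^-1 by rewrite invr_ge0 ltW.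
  exists ((dot (a ord0) x0)^-1 *: x0); split=> [|i|].
  - by rewrite dotZr mulVf // gt_eqF.
  - by rewrite dotZr mulr_ge0_le0.
  - by rewrite dotZr mulr_ge0 // ltW.
(* [pr] is the adjoint of the projection [x - dot (a ord0) x *: q]. It kills [a ord0] because
   [dot (a ord0) q = 1], so projected points meet the first constraint with equality. *)
pose pr (u : 'cV[R]_n) : 'cV[R]_n := u - dot u q *: a ord0.
have prE u x : dot (pr u) x = dot u (x - dot (a ord0) x *: q).
  by rewrite /pr dotDl dotDr dotNl dotNr dotZl dotZr (mulrC (dot u q)).
have [|l l0 bE] := IH (fun i => pr (a' i)) (pr b).
  move=> x hx; rewrite prE; apply: hab => i.
  case: (unliftP ord0 i) => [j|] ->; first by rewrite -prE; exact: hx.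
  by rewrite -prE /pr aq scale1r subrr dotC dot0r.
(* Undoing [pr] on both sides of [bE] leaves this coefficient on [a ord0]; the signs of [bq] and
   [a'q] make it nonnegative. *)
pose l0' := dot b q - \sum_i l i * dot (a' i) q.
exists (fun i => if unlift ord0 i is Some j then l j else l0').
  move=> i; case: unliftP => // _; rewrite subr_ge0 (le_trans _ bq) //.
  by apply: sumr_le0 => j _; rewrite mulr_ge0_le0.
rewrite big_ord_recl unlift_none.
under eq_bigr do rewrite liftK.
have -> : b = pr b + dot b q *: a ord0 by rewrite subrK.
rewrite bE /l0' scalerBl scaler_suml [LHS]addrC -addrA; congr (_ + _).
rewrite -sumrN -big_split /=; apply: eq_bigr => i _.
by rewrite /pr scalerBr scalerA addrC.
Qed.

(** The cone in question is spanned by the columns of [M]; the entries of [M^T *m x] are their dot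
    products with [x]. *)
Lemma farkas (R : realType) n m (M : 'M[R]_(n, m)) (b : 'cV[R]_n) :
  (forall x, lev (M^T *m x) 0 -> dot b x <= 0) ->
  exists2 y : 'cV[R]_m, lev 0 y & b = M *m y.
Proof.
move=> h; have [|l l0 ->] := @farkas_family R n m (fun i => col i M) b.
  move=> x hx; apply: h => i; rewrite !mxE; apply: le_trans (hx i).
  by rewrite dotE; apply/ler_sum => j _; rewrite !mxE.
exists (\col_i l i); first by move=> i; rewrite !mxE.
apply/colP => i; rewrite summxE mxE; apply: eq_bigr => j _.
by rewrite !mxE mulrC.
Qed.

(* If the supremum [s] were not attained, then [A^T z <= t w] and
   [s t <= c^T z] would force [t <= 0]; the Farkas multipliers of this
   implication prove an upper bound strictly below [s]. *)
Lemma lp_max_le (R : realType) n m (A : 'M[R]_(n, m)) (c : 'cV[R]_n)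
    (w : 'cV[R]_m) (B : R) :
  (exists z, lev (A^T *m z) w) ->
  (forall z, lev (A^T *m z) w -> dot c z <= B) ->
  max_le [set dot c z | z in [set z : 'cV[R]_n | lev (A^T *m z) w]] B.
Proof.
move=> [z0 hz0] hB; set S := image _ _.
have Sne : S !=set0 by exists (dot c z0), z0.
have ubB : ubound S B by move=> _ [z hz <-]; exact: hB.
have hS : has_sup S by split=> //; exists B.
have ubS z : lev (A^T *m z) w -> dot c z <= sup S.
  by move=> hz; apply: ub_le_sup; [exists B|exists z].
exists (sup S); last exact: ge_sup.
split; last by move=> _ [z hz <-]; exact: ubS.
apply: contrapT => nS.
(* [M^T] applied to [(z, t)] encodes the two homogenised inequalities, and pairing with [(0, 1)]
   reads off [t]. *)
pose M := block_mx A (- c) (- w^T) (sup S)%:M.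
have [|y] := @farkas R (n + 1) (m + 1) M (col_mx 0 1).
  move=> x; rewrite -[x]vsubmxK; move: (usubmx x) (dsubmx x) => {x} z t.
  rewrite dot_col_mx dot1 dotC dot0r add0r mxE mul1r.
  rewrite tr_block_mx mul_block_col -[X in lev _ X]vsubmxK.
  move=> /lev_col_mx[h1 h2]; rewrite leNgt; apply/negP => t0.
  (* For [t > 0] the point [z / t] is feasible with value at least [sup S], hence attains it. *)
  apply: nS; have hz : lev (A^T *m ((t 0 0)^-1 *: z)) w.
    move=> i; rewrite -scalemxAr mxE ler_pdivrMl //.
    have := h1 i; rewrite linearN /= trmxK mulNmx !mxE big_ord1.
    by rewrite !ord1 (mulrC (t 0 0)); lra.
  exists ((t 0 0)^-1 *: z) => //.
  apply/eqP; rewrite eq_le ubS //= dotZr ler_pdivlMl //.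
  have := h2 0; rewrite linearN /= tr_scalar_mx mul_scalar_mx mulNmx !mxE.
  by rewrite /dot mxE addrC subr_le0 mulrC.
rewrite -[y]vsubmxK; move: (usubmx y) (dsubmx y) => {}y s.
rewrite -[X in lev X _]vsubmxK => /lev_col_mx[y0 s0].
rewrite mul_block_col => /eq_col_mx[/esym cE /matrixP/(_ 0 0) oneE].
have {}y0 : lev 0 y by move=> i; have := y0 i; rewrite !mxE.
have {}s0 : 0 <= s 0 0 by have := s0 0; rewrite !mxE.
have {}cE : A *m y = s 0 0 *: c.
  move/eqP: cE; rewrite mulNmx subr_eq0 => /eqP ->.
  by apply/colP => i; rewrite !mxE big_ord1 mulrC.
have {}oneE : 1 = s 0 0 * sup S - dot y w.
  move: oneE; rewrite mul_scalar_mx mulNmx [X in X = _]mxE eqxx.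
  move=> E; apply: (etrans E).
  by rewrite 2!mxE -/(dot w y) mxE dotC addrC mulrC.
(* Weak duality with the multipliers: [s * dot c z = dot y (A^T *m z) <= dot y w = s * sup S -
   1]. *)
have bnd z : lev (A^T *m z) w -> s 0 0 * dot c z <= s 0 0 * sup S - 1.
  move=> hz; rewrite -dotZl -cE dot_mulmxl (le_trans (ler_dot y0 hz)) //.
  by rewrite [X in _ - X]oneE; lra.
(* If [s] vanished, [bnd] at the feasible point [z0] would read [0 <= -1]. *)
have {}s0 : 0 < s 0 0.
  rewrite lt_neqAle s0 andbT; apply/eqP => s00.
  by have := bnd _ hz0; rewrite -s00 !mul0r; lra.
have : sup S <= sup S - (s 0 0)^-1.
  apply: ge_sup => // _ [z hz <-].
  rewrite -(ler_pM2l s0) mulrBr divff ?gt_eqF //; exact: bnd.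
by rewrite lerBrDr gerDl leNgt invr_gt0 s0.
Qed.

Lemma is_flow_mx (R : realType) (G : sgraph) (gamma : 'cV[R]_(order_of G))
    (omega : edge G -> R) :
  is_flow gamma omega <->
  incidence R G *m \col_k omega (enum_val k) = gamma.
Proof.
have E (v : G) : (incidence R G *m \col_k omega (enum_val k)) (enum_rank v) 0
    = \sum_(e : edge G | v \in val e) omega e.
  rewrite mxE [RHS]big_mkcond.
  rewrite [RHS](reindex _ (onW_bij _ (@enum_val_bij (edge G)))).
  apply: eq_bigr => k _; rewrite !mxE enum_rankK.
  by case: ifP; rewrite (mul1r, mul0r).
split=> [h|<- v]; last by rewrite E.
by apply/colP => i; rewrite -[i]enum_valK E h.
Qed.

(** A vertex [v] lies on [deg v] edges, so raising every edge by [a] raises its sum by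
    [a * deg v]. *)
Lemma is_flow_shift (R : realType) (G : sgraph) (gamma : 'cV[R]_(order_of G))
    (a : R) (omega : edge G -> R) :
  is_flow gamma omega ->
  is_flow (gamma + a *: degvec R G) (fun e => omega e + a).
Proof.
move=> h v; rewrite big_split /= h !mxE enum_rankK; congr (_ + _).
rewrite sumr_const /deg mulr_natr; congr (_ *+ _).
by apply: eq_card => e; rewrite inE.
Qed.

Theorem theorem1 (R : realType) (G : sgraph) (hG : no_isolated G)
    (c a b : R) (hab : a <= b) :
  let n := order_of G in
  let m := size_of G in
  let A : 'M[R]_(n, m) := incidence R G in
  let gamma : 'cV[R]_n := c *: ones R n - a *: degvec R G in
  let P1 := exists omega : edge G -> R, is_csum_flow c `[a, b] omega in
  let P2 := exists omega : edge G -> R,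
    [/\ is_flow gamma omega,
        (forall e, 0 <= omega e)
      & (forall e, omega e <= b - a)] in
  let P3 := forall w : 'cV[R]_m, lev 0 w ->
    max_le [set dot gamma z | z in [set z : 'cV[R]_n | lev (A^T *m z) w]]
           ((b - a) * dot (ones R m) w) in
  (P1 <-> P2) /\ (P2 <-> P3).
Proof.
move=> n m A gamma P1 P2 P3; split; split.
- move=> [omega [h hL]]; exists (fun e => omega e - a); split.
  + by have := is_flow_shift (- a) h; rewrite scaleNr.
  + by move=> e; have := hL e; rewrite /= in_itv /= => /andP[]; lra.
  + by move=> e; have := hL e; rewrite /= in_itv /= => /andP[]; lra.
- move=> [omega [h h0 h1]]; exists (fun e => omega e + a); split.
    by have := is_flow_shift a h; rewrite subrK.
  by move=> e; rewrite /= in_itv /=; have := h0 e; have := h1 e; lra.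
- move=> [omega [/is_flow_mx hf h0 h1]] w w0; apply: lp_max_le.
    by exists 0; rewrite mulmx0.
  (* The chain is [dot gamma z = dot omega (A^T *m z) <= dot omega w <= (b - a) * dot 1 w], using
     first [omega >= 0], then [omega <= b - a] and [w >= 0]. *)
  move=> z hz; rewrite -hf dot_mulmxl.
  apply: (le_trans (ler_dot _ hz)); first by move=> i; rewrite !mxE.
  rewrite -dotZl dotC [leRHS]dotC; apply: ler_dot => // i.
  by rewrite !mxE mulr1.
- move=> h3; pose M : 'M[R]_(n + m, m + m) := block_mx A 0 1%:M 1%:M.
  have [|y] := @farkas R _ _ M (col_mx gamma ((b - a) *: ones R m)).
    move=> x; rewrite -[x]vsubmxK; move: (usubmx x) (dsubmx x) => {x} z u.
    rewrite tr_block_mx mul_block_col trmx0 !trmx1 mul0mx add0r !mul1mx.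
    rewrite -[X in lev _ X]vsubmxK => /lev_col_mx[hz hu].
    (* The dual inequalities are [A^T *m z + u <= 0] and [u <= 0]. Hence [- u] is an admissible
       weight in [P3], and [z] is feasible for it. *)
    have u0 : lev 0 (- u).
      by move=> i; have := hu i; rewrite !mxE oppr_ge0.
    have [s [_ ub] sle] := h3 _ u0.
    have /ub/le_trans/(_ sle) : [set dot gamma z | z in
        [set z : 'cV[R]_n | lev (A^T *m z) (- u)]] (dot gamma z).
      by exists z => // i; have := hz i; rewrite !mxE; lra.
    by rewrite dot_col_mx dotZl dotNr; lra.
  rewrite -[y]vsubmxK; move: (usubmx y) (dsubmx y) => {}y s.
  rewrite -[X in lev X _]vsubmxK => /lev_col_mx[y0 s0].
  rewrite mul_block_col mul0mx addr0 !mul1mx => /eq_col_mx[gE bE].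
  (* The first block [y] of the Farkas solution is the flow; the second, [s], is the slack below
     [b - a], whose nonnegativity gives the upper bound. *)
  exists (fun e => y (enum_rank e) 0); split.
  + apply/is_flow_mx; rewrite gE; congr (_ *m _).
    by apply/colP => i; rewrite mxE enum_valK.
  + by move=> e; have := y0 (enum_rank e); rewrite !mxE.
  + move=> e; have := s0 (enum_rank e).
    by move/colP/(_ (enum_rank e)): bE; rewrite !mxE; lra.
Qed.
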